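(* Let $p$ be a prime, let $\nu$ be a positive integer and let $k\ge 0$ be an integer. Let $A$ be a finite abelian group of order $m$ such that $p\nmid m$. Then the following statements hold. 1. $\mathrm{avg}_{p^\nu}^{\rm E}(A\times\mathbb{Z}_{p^k})<\frac{mp^k}{3}$. 2. $\mathrm{avg}_{p^\nu}^{\rm E}(A)=\frac{m-|Q_{p^\nu}(A)|}{4}$. 3. $\mathrm{avg}_{p^\nu}^{\rm E}(A)\le\frac{m-1}{4}$.
   Context: For a finite abelian group $G$ (written additively), $\mathbb{F}_{p^\nu}[G]$ is the group algebra, with elements written $\sum_{g\in G}u_gY^g$. An abelian code in $\mathbb{F}_{p^\nu}[G]$ is an ideal of $\mathbb{F}_{p^\nu}[G]$, and $\mathcal{C}(p^\nu,G)$ is the set of all of them. The Euclidean inner product is $\langle u,v\rangle_{\rm E}=\sum_{g\in G}u_gv_g$; the Euclidean dual of a code $C$ is $C^{\perp_{\rm E}}=\{v\in\mathbb{F}_{p^\nu}[G] : \langle c,v\rangle_{\rm E}=0 \text{ for all } c\in C\}$, and the Euclidean hull is $\mathcal{H}_{\rm E}(C)=C\cap C^{\perp_{\rm E}}$. The average dimension of the Euclidean hull is $$\mathrm{avg}_{p^\nu}^{\rm E}(G)=\frac{\sum_{C\in\mathcal{C}(p^\nu,G)}\dim_{\mathbb{F}_{p^\nu}}(\mathcal{H}_{\rm E}(C))}{|\mathcal{C}(p^\nu,G)|}.$$ For $q$ coprime to $|A|$, the $q$-cyclotomic class of $a\in A$ is $S_q(a)=\{q^i\cdot a : i=0,1,2,\dots\}$,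 and $Q_{p^\nu}(A)=\{a\in A : -a\in S_{p^\nu}(a)\}$. $\mathbb{Z}_{p^k}$ is the cyclic group of order $p^k$. *)

(* Defs.v *)
From HB Require Import structures.
From mathcomp Require Import all_boot all_order all_algebra all_field.

Set Implicit Arguments.
Unset Strict Implicit.
Unset Printing Implicit Defensive.

Import Order.TTheory GRing.Theory Num.Theory.
Local Open Scope ring_scope.

HB.instance Definition _ (A B : finZmodType) := GRing.Zmodule.on (A * B)%type.

(* The additive group Z/n for n > 0.  It differs from 'Z_n, which is Z/2 when *)
(* n = 1; here 'I_1 is the trivial group.                                     *)
Notation Zmod n := 'I_n.-1.+1.

(* The group algebra F[G]: the function u stands for \sum_g u g *: Y^g.  This *)
(* alias of {ffun G -> F} keeps the convolution product apart from MathComp's *)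
(* pointwise product on finite functions.                                     *)
Definition group_algebra (F : finFieldType) (G : finZmodType) : Type :=
  {ffun G -> F^o}.

Section GroupAlgebra.
Variables (F : finFieldType) (G : finZmodType).
Local Notation FG := (group_algebra F G).

HB.instance Definition _ := Finite.copy FG {ffun G -> F^o}.
HB.instance Definition _ := GRing.Zmodule.copy FG {ffun G -> F^o}.
HB.instance Definition _ := GRing.Lmodule.copy FG {ffun G -> F^o}.
HB.instance Definition _ := Vector.copy FG {ffun G -> F^o}.

Definition coef (u : FG) (g : G) : F := (u : {ffun G -> F^o}) g.
Definition mkga (f : G -> F) : FG := ([ffun g => f g] : {ffun G -> F^o}).

Lemma coefE f g : coef (mkga f) g = f g.
Proof. by rewrite /coef ffunE. Qed.

Lemma gaP (u v : FG) : (forall g, coef u g = coef v g) -> u = v.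
Proof. by move=> uv; apply/ffunP => g; apply: uv. Qed.

Lemma coefD (u v : FG) g : coef (u + v) g = coef u g + coef v g.
Proof. by rewrite /coef ffunE. Qed.

Lemma coef0 g : coef (0 : FG) g = 0.
Proof. by rewrite /coef ffunE. Qed.

Lemma coefZ a (u : FG) g : coef (a *: u) g = a * coef u g.
Proof. by rewrite /coef ffunE. Qed.

Definition gmon (g : G) : FG := mkga (fun h => (h == g)%:R).
Definition ga_mul (u v : FG) : FG :=
  mkga (fun g => \sum_h coef u h * coef v (g - h)).

Fact ga_mulC : commutative ga_mul.
Proof.
move=> u v; apply: gaP => g; rewrite !coefE.
rewrite (reindex_inj (h := fun h => g - h)) /=; last first.
  by move=> x y /addrI /oppr_inj.
by apply: eq_bigr => h _; rewrite mulrC opprB addrC subrK.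
Qed.

Fact ga_mulA : associative ga_mul.
Proof.
move=> u v w; apply: gaP => g; rewrite !coefE.
under eq_bigr => h _ do rewrite coefE mulr_sumr.
under [RHS]eq_bigr => h _ do rewrite coefE mulr_suml.
rewrite [RHS]exchange_big /=; apply: eq_bigr => h _.
rewrite [RHS](reindex_inj (addIr h)) /=; apply: eq_bigr => k _.
by rewrite addrK mulrA [k + h]addrC opprD addrA.
Qed.

Fact ga_mul1 : left_id (gmon 0) ga_mul.
Proof.
move=> u; apply: gaP => g; rewrite coefE (bigD1 0) //= coefE eqxx mul1r subr0.
by rewrite big1 ?addr0 // => h /negPf h0; rewrite coefE h0 mul0r.
Qed.

Fact ga_mulDl : left_distributive ga_mul +%R.
Proof.
move=> u v w; apply: gaP => g; rewrite coefD !coefE -big_split /=.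
by apply: eq_bigr => h _; rewrite coefD mulrDl.
Qed.

Fact ga_1neq0 : gmon 0 != 0.
Proof.
apply/eqP => /(congr1 (coef^~ 0)); rewrite coefE coef0 eqxx => /eqP.
by rewrite oner_eq0.
Qed.

HB.instance Definition _ := GRing.Zmodule_isComNzRing.Build FG
  ga_mulA ga_mulC ga_mul1 ga_mulDl ga_1neq0.

Fact ga_scaleAl a (u v : FG) : a *: (u * v) = (a *: u) * v.
Proof.
apply: gaP => g; rewrite coefZ !coefE mulr_sumr.
by apply: eq_bigr => h _; rewrite coefZ mulrA.
Qed.

HB.instance Definition _ := GRing.Lmodule_isLalgebra.Build F FG ga_scaleAl.
HB.instance Definition _ := GRing.Lalgebra_isComAlgebra.Build F FG.

Lemma gmonD g h : gmon (g + h) = gmon g * gmon h.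
Proof.
apply: gaP => k; rewrite !coefE (bigD1 g) //= !coefE eqxx mul1r subr_eq.
rewrite [h + g]addrC big1 ?addr0 // => i /negPf ig.
by rewrite coefE ig mul0r.
Qed.

Lemma ga_sumE (u : FG) : u = \sum_g coef u g *: gmon g.
Proof.
apply: gaP => h; rewrite (big_morph (coef^~ h) (fun u v => coefD u v h) (coef0 h)).
rewrite (bigD1 h) //= coefZ coefE eqxx mulr1 big1 ?addr0 // => g gh.
by rewrite coefZ coefE eq_sym (negPf gh) mulr0.
Qed.

Definition is_ideal (C : {set FG}) : bool :=
  [&& 0 \in C, [forall u in C, forall v in C, u + v \in C]
    & [forall a, forall u in C, a * u \in C]].

Definition abelian_codes : {set {set FG}} := [set C | is_ideal C].

Definition inner (u v : FG) : F := \sum_g coef u g * coef v g.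

Definition dual (C : {set FG}) : {set FG} :=
  [set v | [forall c in C, inner c v == 0]].

Definition hull (C : {set FG}) : {set FG} := C :&: dual C.

(* The dimension of the linear span; it is only used on hulls of codes, which *)
(* are their own spans by span_code and hull_code.                            *)
Definition code_dim (C : {set FG}) : nat := \dim <<enum C>>%VS.

Definition avg_hull_dim : rat :=
  (\sum_(C in abelian_codes) (code_dim (hull C))%:R) / #|abelian_codes|%:R.

Lemma abelian_codesP (C : {set FG}) :
  reflect [/\ 0 \in C, {in C &, forall u v, u + v \in C}
            & forall a, {in C, forall u, a * u \in C}]
          (C \in abelian_codes).
Proof.
rewrite inE; apply: (iffP and3P) => -[C0 CD CM]; split=> //.
- by move=> u v uC vC; move/forall_inP: CD => /(_ u uC) /forall_inP; apply.
- by move=> a u uC; move/forallP: CM => /(_ a) /forall_inP; apply.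
- by apply/forall_inP => u uC; apply/forall_inP => v vC; apply: CD.
- by apply/forallP => a; apply/forall_inP => u uC; apply: CM.
Qed.

Lemma span_code (C : {set FG}) : C \in abelian_codes ->
  forall u, (u \in <<enum C>>%VS) = (u \in C).
Proof.
case/abelian_codesP => C0 CD CM u; apply/idP/idP => [|uC]; last first.
  by apply: memv_span; rewrite mem_enum.
rewrite -[enum C]/(tval (in_tuple (enum C))) => /coord_span ->.
apply: (big_ind (fun u => u \in C)) => // i _.
rewrite -mulr_algl; apply: CM; rewrite -mem_enum; exact: mem_nth.
Qed.

Lemma inner_gmonM g (u v : FG) : inner u (gmon g * v) = inner (gmon (- g) * u) v.
Proof.
have gM h (w : FG) k : coef (gmon h * w) k = coef w (k - h).
  rewrite coefE (bigD1 h) //= coefE eqxx mul1r big1 ?addr0 // => i /negPf ih.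
  by rewrite coefE ih mul0r.
rewrite /inner (reindex_inj (addIr g)) /=; apply: eq_bigr => h _.
by rewrite !gM addrK opprK.
Qed.

Lemma hull_code (C : {set FG}) : C \in abelian_codes -> hull C \in abelian_codes.
Proof.
case/abelian_codesP => C0 CD CM.
have innerD c (u v : FG) : inner c (u + v) = inner c u + inner c v.
  by rewrite /inner -big_split; apply: eq_bigr => g _; rewrite coefD mulrDr.
have innerZ c a (u : FG) : inner c (a *: u) = a * inner c u.
  by rewrite /inner mulr_sumr; apply: eq_bigr => g _; rewrite coefZ mulrCA.
have inner0 c : inner c 0 = 0 by rewrite -(scale0r (0 : FG)) innerZ mul0r.
apply/abelian_codesP; split.
- by rewrite !inE C0; apply/forall_inP => c _; rewrite inner0.
- move=> u v; rewrite !inE => /andP[uC /forall_inP uD] /andP[vC /forall_inP vD].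
  rewrite CD //; apply/forall_inP => c cC.
  by rewrite innerD (eqP (uD c cC)) (eqP (vD c cC)) addr0.
move=> a u; rewrite !inE => /andP[uC /forall_inP uD]; rewrite CM //=.
apply/forall_inP => c cC; rewrite [a]ga_sumE mulr_suml.
rewrite (big_morph (inner c) (innerD c) (inner0 c)) big1 // => g _.
by rewrite -scalerAl innerZ inner_gmonM (eqP (uD _ (CM _ _ cC))) mulr0.
Qed.

End GroupAlgebra.

Section CyclotomicClasses.
Variable A : finZmodType.

(* The iterates of a |-> q . a are the multiples q^i . a; see cyclotomicP.    *)
Definition cyclotomic_class (q : nat) (a : A) : {set A} :=
  [set b | fconnect (fun x : A => x *+ q) a b].

Lemma cyclotomicP q (a b : A) :
  reflect (exists i : nat, b = a *+ (q ^ i)) (b \in cyclotomic_class q a).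
Proof.
have iterE i : iter i (fun x : A => x *+ q) a = a *+ (q ^ i).
  by elim: i => //= i ->; rewrite -mulrnA expnSr.
rewrite inE; apply: (iffP idP) => [/iter_findex <-|[i ->]].
  by eexists; rewrite iterE.
by rewrite -iterE fconnect_iter.
Qed.

Definition self_paired (q : nat) : {set A} :=
  [set a | - a \in cyclotomic_class q a].

End CyclotomicClasses.

(* Main.v *)
(* Let N = p^k and let Q be a power of q = |F| that is a multiple of N and is   *)
(* congruent to 1 modulo |A|.  In R = F[A x Z_N] the map u |-> u^Q is an        *)
(* F-algebra endomorphism projecting R onto F[A], so for a primitive idempotent *)
(* f of R and v in F[A] the element f v^(Q-1) is 0 or f, and every f u is       *)
(* f pi^j w with w a unit of fR, where pi = Y^z - 1 for a generator z of Z_N.   *)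
(* Hence codes correspond to functions i from the primitive idempotents to      *)
(* {0..N}, and with the involution * induced by g |-> -g the hull of the code i *)
(* is the code                                                                  *)
(* f |-> max(i f, N - i f* ).  Averaging N - max(i f, N - i f* ) over i gives   *)
(* less than N/3 for every f; for N = 1 it gives 1/4 if f* <> f and 0 otherwise.*)
(*   For N = 1 it remains to see that the components fR with f* = f have total  *)
(* dimension |Q_q(A)|.  By a trace argument and Artin's independence of         *)
(* characters, f* = f iff f Y^((q^j + 1) a) = f for all a and some j.  The      *)
(* components where nA acts trivially make up R^(nA), which has dimension       *)
(* |A / nA| = |A[n]|, and inclusion-exclusion over the n = q^j + 1 compares     *)
(* the two counts.                                                              *)
Require Import Defs.
From HB Require Import structures.
From mathcomp Require Import all_boot all_order all_algebra all_field.
From mathcomp Require Import cyclic ring zify.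

Set Implicit Arguments.
Unset Strict Implicit.
Unset Printing Implicit Defensive.

Import Order.TTheory GRing.Theory Num.Theory.
(* coefE, coefD, etc. are those of group algebras, not of polynomials. *)
Import Defs.
Local Open Scope ring_scope.

(** Multiplying by the primitive idempotents f ([sum_atom]) splits the group algebra into rings fR
    whose ideals are the powers of [chain_pi]: by [atom_chain], each element of fR is such a power
    times a unit. A code is thus a free choice of an exponent i f in 0..N for each f
    ([chain_code_inj], [chain_code_surj]), and by [dim_P] exponent j contributes dimension (N - j) d
    f. For ideals, orthogonality to c means that star c annihilates ([dual_codeP]). Writing f' for
    star f, duality turns i f into N - i f', and the hull has dimension the sum of d f min(N - i f,
    i f') ([avg_hull_dim_chain]).

    For uniformly random i each f is averaged separately. If f' differs from f, the two exponents
    are independent and the mean minimum is N(2N+1)/(6(N+1)); if f' = f, it is at most N^2/(4(N+1)).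
    Both are below N/3, which gives statement 1. For N = 1 the means are 1/4 and 0, so statement 2
    asks that the components moved by star have total dimension m - |Q(A)|, which is
    [sum_starT_moved]. A component is fixed iff some q^j + 1 acts trivially on it, an element is
    self-paired iff some q^j + 1 kills it, and the components on which nA acts trivially have as
    much total dimension as there are elements killed by n. Statement 3 follows since 0 is
    self-paired. *)

(** * The involution induced by negation, and duality of ideals *)

Section Involution.
Variables (F : finFieldType) (G : finZmodType).
Local Notation FG := (group_algebra F G).
Implicit Types (u v w : FG) (g h : G) (n : nat).

Lemma coef_sum I (r : seq I) (P : pred I) (E : I -> FG) g :
  coef (\sum_(i <- r | P i) E i) g = \sum_(i <- r | P i) coef (E i) g.
Proof.
exact: (big_morph (fun u : FG => coef u g) (fun u v => coefD u v g) (coef0 F g)).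
Qed.

Lemma coef_gmonM g u h : coef (gmon F g * u) h = coef u (h - g).
Proof.
rewrite coefE (bigD1 g) //= coefE eqxx mul1r big1 ?addr0 // => i /negPf ig.
by rewrite coefE ig mul0r.
Qed.

Lemma gmonX g n : gmon F g ^+ n = gmon F (g *+ n).
Proof. by elim: n => // n IHn; rewrite exprS IHn mulrS gmonD. Qed.

Definition star u : FG := mkga (fun g => coef u (- g)).

Lemma starK : involutive star.
Proof. by move=> u; apply: gaP => g; rewrite !coefE opprK. Qed.

Lemma starD : {morph star : u v / u + v}.
Proof. by move=> u v; apply: gaP => g; rewrite [LHS]coefE !coefD !coefE. Qed.

Lemma star0 : star 0 = 0.
Proof. by apply: gaP => g; rewrite coefE !coef0. Qed.

Lemma starZ (a : F) : {morph star : u / a *: u}.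
Proof. by move=> u; apply: gaP => g; rewrite [LHS]coefE !coefZ coefE. Qed.

Lemma starM : {morph star : u v / u * v}.
Proof.
move=> u v; apply: gaP => g; rewrite !coefE (reindex_inj oppr_inj) /=.
by apply: eq_bigr => h _; rewrite !coefE opprD.
Qed.

Lemma star_gmon g : star (gmon F g) = gmon F (- g).
Proof. by apply: gaP => h; rewrite !coefE eqr_oppLR. Qed.

Lemma star1 : star 1 = 1.
Proof. by rewrite [LHS]star_gmon oppr0. Qed.

Lemma starX n : {morph star : u / u ^+ n}.
Proof.
by move=> u; elim: n => [|n IHn]; rewrite ?star1 // !exprS starM IHn.
Qed.

Lemma inner_star u v : inner u v = coef (star u * v) 0.
Proof.
rewrite coefE [RHS](reindex_inj oppr_inj) /=.
by apply: eq_bigr => h _; rewrite coefE !opprK add0r.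
Qed.

Lemma dual_codeP (C : {set FG}) v : C \in abelian_codes F G ->
  reflect {in C, forall c, star c * v = 0} (v \in dual C).
Proof.
case/abelian_codesP=> _ _ CM; rewrite inE.
apply: (iffP forall_inP) => Cv c cC; last by rewrite inner_star Cv ?coef0.
apply: gaP => g; have := eqP (Cv _ (CM (gmon F g) _ cC)).
rewrite inner_star starM star_gmon -mulrA coef_gmonM sub0r opprK => ->.
by rewrite coef0.
Qed.

End Involution.

(** * Frobenius powers in the group algebra *)

Section Frobenius.
Variables (p nu : nat) (F : finFieldType) (G : finZmodType).
Hypotheses (p_prime : prime p) (cardF : #|F| = (p ^ nu)%N).
Local Notation FG := (group_algebra F G).
Implicit Types (u v w : FG) (g h : G).

Lemma FG_exprDn j u v : (u + v) ^+ (p ^ j) = u ^+ (p ^ j) + v ^+ (p ^ j).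
Proof.
apply: exprDn_pchar; rewrite pnatX pnatE // pchar_lalg.
by rewrite (card_finPcharP cardF p_prime).
Qed.

Lemma FG_frobenius j u :
  u ^+ (#|F| ^ j) = \sum_g coef u g *: gmon F (g *+ (#|F| ^ j)).
Proof.
have expD v w : (v + w) ^+ (#|F| ^ j) = v ^+ (#|F| ^ j) + w ^+ (#|F| ^ j).
  by rewrite cardF -expnM FG_exprDn.
have exp0 : (0 : FG) ^+ (#|F| ^ j) = 0.
  by rewrite expr0n expn_eq0 -leqn0 leqNgt (ltnW (card_finNzRing_gt1 _)).
rewrite {1}[u]ga_sumE (big_morph (fun v => v ^+ (#|F| ^ j)) expD exp0).
apply: eq_bigr => g _; rewrite exprZn gmonX; congr (_ *: _).
elim: j {expD exp0} => [|j IHj]; first by rewrite expr1.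
by rewrite expnSr exprM IHj expf_card.
Qed.

End Frobenius.

(** * Decomposition of 1 into primitive idempotents *)

Section PrimitiveIdempotents.
Variables (F : finFieldType) (G : finZmodType).
Local Notation FG := (group_algebra F G).
Implicit Types (u v w e f : FG).

Definition primitive_idempotent e : bool :=
  [&& e != 0, e * e == e & [forall x : FG, (x * x == x) ==> (e * x \in [:: 0; e])]].

Lemma primitive_idempotentP e :
  reflect [/\ e != 0, e * e = e & forall x, x * x = x -> e * x = 0 \/ e * x = e]
          (primitive_idempotent e).
Proof.
apply: (iffP and3P) => [] [e0 ee].
  move=> /forallP eP; split=> // [|x xx]; first exact/eqP.
  by have:= eP x; rewrite xx eqxx !inE => /orP [/eqP|/eqP]; [left|right].
move=> eP; split=> //; first exact/eqP.
apply/forallP=> x; apply/implyP=> /eqP /eP [->|->]; by rewrite !inE eqxx ?orbT.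
Qed.

(** Among the nonzero idempotents f below e, one whose ideal fR is smallest is primitive: a nonzero
    product fx with an idempotent x generates the same ideal, which forces fx = f. *)
Lemma primitive_idempotent_below e : e != 0 -> e * e = e ->
  exists2 f, primitive_idempotent f & f * e = f.
Proof.
move=> e0 ee; pose P f := [&& f != 0, f * f == f & f * e == f].
pose rank f := #|[set f * u | u : FG]|.
have Pe : P e by rewrite /P e0 ee eqxx.
case: (arg_minnP rank Pe) => f /and3P[f0 /eqP ff /eqP fe] f_min; exists f => //.
apply/primitive_idempotentP; split=> // x xx.
have [->|fx0] := eqVneq (f * x) 0; [by left | right].
have sub : [set f * x * u | u : FG] \subset [set f * u | u : FG].
  by apply/subsetP=> _ /imsetP[u _ ->]; rewrite -mulrA; apply: imset_f.
have : f \in [set f * x * u | u : FG].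
  have /eqP-> : [set f * x * u | u : FG] == [set f * u | u : FG].
    rewrite eqEcard sub f_min //; apply/and3P; split=> //; apply/eqP.
      by rewrite mulrACA ff xx.
    by rewrite mulrAC fe.
  by apply/imsetP; exists f.
by case/imsetP=> u _ fE; rewrite {1}fE mulrAC -(mulrA f) xx -fE.
Qed.

Local Notation atom := {e : FG | primitive_idempotent e}.
Implicit Types (a b : atom).

Lemma atom_neq0 a : val a != 0.
Proof. by case/primitive_idempotentP: (valP a). Qed.

Lemma atomM a : val a * val a = val a.
Proof. by case/primitive_idempotentP: (valP a). Qed.

Lemma atomMl a u : val a * (val a * u) = val a * u.
Proof. by rewrite mulrA atomM. Qed.

Lemma atom_idem a x : x * x = x -> val a * x = 0 \/ val a * x = val a.
Proof. by case/primitive_idempotentP: (valP a) => _ _; apply. Qed.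

Lemma atom_ortho a b : a != b -> val a * val b = 0.
Proof.
move=> ab; case: (atom_idem a (atomM b)) => // abE.
have [|baE] := atom_idem b (atomM a); first by rewrite mulrC.
by case/eqP: ab; apply: val_inj; rewrite -abE mulrC.
Qed.

Lemma sum_atom : \sum_(a : atom) val a = 1.
Proof.
set s := \sum_(a : atom) val a; have atom_s a : val a * s = val a.
  rewrite mulr_sumr (bigD1 a) //= atomM big1 ?addr0 // => b ba.
  by rewrite atom_ortho // eq_sym.
(* If the idempotent 1 - s were nonzero, a primitive idempotent below it would be annihilated by s,
   against [atom_s]. *)
apply/eqP; rewrite eq_sym -subr_eq0; apply/negP => /negP s1.
have ss : s * s = s by rewrite mulr_suml; apply: eq_bigr => a _; rewrite atom_s.
have [|f f_prim fs] := primitive_idempotent_below s1.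
  by rewrite mulrBl mul1r mulrBr mulr1 ss subrr subr0.
have := atom_s (Sub f f_prim); rewrite SubK => fE.
by have := atom_neq0 (Sub f f_prim); rewrite SubK -fs mulrBr mulr1 fE subrr eqxx.
Qed.

Lemma atom_decomp u : u = \sum_(a : atom) val a * u.
Proof. by rewrite -mulr_suml sum_atom mul1r. Qed.

Lemma atom_ext u v : (forall a, val a * u = val a * v) -> u = v.
Proof. by move=> uv; rewrite [u]atom_decomp [v]atom_decomp; apply: eq_bigr. Qed.

Lemma star_primitive f : primitive_idempotent f -> primitive_idempotent (star f).
Proof.
case/primitive_idempotentP => f0 ff fP; apply/primitive_idempotentP; split.
- by rewrite -(can_eq (@starK F G)) starK star0.
- by rewrite -starM ff.
move=> x xx; have [|fx|fx] := fP (star x); first by rewrite -starM xx.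
  by left; apply: (can_inj (@starK F G)); rewrite starM starK fx star0.
by right; apply: (can_inj (@starK F G)); rewrite starM starK fx.
Qed.

Definition starT a : atom := Sub (star (val a)) (star_primitive (valP a)).

Lemma dim_sum_atom (P : pred atom) (U : atom -> {vspace FG}) :
  (forall a u, u \in U a -> val a * u = u) ->
  \dim (\sum_(a | P a) U a) = (\sum_(a | P a) \dim (U a))%N.
Proof.
move=> UP; apply/directvP/directv_sum_independent => us usU us0 a Pa.
have := congr1 ( *%R (val a)) us0; rewrite mulr0 mulr_sumr (bigD1 a) //=.
rewrite (UP a) ?usU // big1 ?addr0 // => b /andP[Pb ba].
by rewrite -(UP b (us b)) ?usU // mulrA atom_ortho ?mul0r // eq_sym.
Qed.

End PrimitiveIdempotents.

(** * Principal ideals and spaces of elements with given support *)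

Section PrincipalIdeals.
Variables (F : finFieldType) (G : finZmodType).
Local Notation FG := (group_algebra F G).
Implicit Types (u v w : FG) (S : {set G}).

Definition mulv w : 'End(FG) := linfun (w \*o idfun).

Lemma mulvE w u : mulv w u = w * u.
Proof. by rewrite lfunE. Qed.

Lemma mem_limg_mulv w u : reflect (exists v, u = w * v) (u \in limg (mulv w)).
Proof.
apply: (iffP memv_imgP) => [[v _ ->]|[v ->]]; exists v; rewrite ?mulvE ?memvf //.
Qed.

Definition supp_space S : {vspace FG} := <<[seq gmon F g | g <- enum S]>>%VS.

Lemma mem_supp_spaceP S u :
  reflect (forall g, g \notin S -> coef u g = 0) (u \in supp_space S).
Proof.
apply: (iffP idP) => [uS g gS|uS]; last first.
  rewrite [u]ga_sumE; apply: memv_suml => g _; have [gS|gS] := boolP (g \in S).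
    by rewrite memvZ // memv_span // map_f // mem_enum.
  by rewrite uS // scale0r mem0v.
move: uS; rewrite /supp_space -[map _ _]/(tval (in_tuple _)) => /coord_span ->.
rewrite coef_sum big1 // => i _; rewrite coefZ.
have /mapP[h] : (in_tuple [seq gmon F g | g <- enum S])`_i
    \in [seq gmon F g | g <- enum S] by apply: mem_nth.
rewrite mem_enum => hS ->; rewrite coefE; case: eqP => [gh|]; last by rewrite mulr0.
by rewrite gh hS in gS.
Qed.

Lemma dim_FG : \dim {:FG} = #|G|.
Proof. by rewrite dimvf /dim /= muln1. Qed.

Lemma dim_supp_space S : \dim (supp_space S) = #|S|.
Proof.
have le T : (\dim (supp_space T) <= #|T|)%N.
  by apply: leq_trans (dim_span _) _; rewrite size_map -cardE.
(* The upper bounds for S and for its complement add up to the full dimension, so both are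
   attained. *)
apply/eqP; rewrite eqn_leq le /= -(leq_add2r #|~: S|) cardsC -dim_FG.
apply: leq_trans (leq_add (leqnn _) (le (~: S))).
suff -> : fullv = (supp_space S + supp_space (~: S))%VS.
  by case: (dimv_add_leqif (supp_space S) (supp_space (~: S))).
apply/eqP; rewrite eqEsubv subvf andbT; apply/subvP => u _.
have -> : u = mkga (fun g => if g \in S then coef u g else 0)
            + mkga (fun g => if g \in S then 0 else coef u g).
  by apply: gaP => g; rewrite coefD !coefE; case: ifP; rewrite ?addr0 ?add0r.
apply: memv_add; apply/mem_supp_spaceP => g; rewrite coefE ?inE ?negbK.
  by move/negPf->.
by move->.
Qed.

End PrincipalIdeals.

(** * The components fR as chain rings *)

Section ChainComponents.
Variables (p nu k D : nat) (F : finFieldType) (G : finZmodType) (z : G).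
Local Notation FG := (group_algebra F G).
Local Notation Q := (#|F| ^ D)%N.
Local Notation N := (p ^ k)%N.
Local Notation QG := [set g *+ Q | g : G].
Hypotheses (p_prime : prime p) (cardF : #|F| = (p ^ nu)%N) (D_gt0 : (0 < D)%N).
(* These hold for G = A x Z_N with z a generator of Z_N, and for G = A with     *)
(* z = 0 and N = 1, which avoids transporting codes from A x Z_1 to A.          *)
Hypothesis mulQ_idem : forall g : G, g *+ Q *+ Q = g *+ Q.
Hypothesis mulz_N : z *+ N = 0.
Hypothesis G_gen : forall g : G, exists t, g = g *+ Q + z *+ t.
Hypothesis card_G : #|G| = (N * #|QG|)%N.
Local Notation atom := {e : FG | primitive_idempotent e}.
Implicit Types (u v w : FG) (g h : G) (a b : atom).

Definition chain_pi : FG := gmon F z - 1.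
Local Notation pi := chain_pi.
Local Notation P a j := (limg (mulv (val a * pi ^+ j))).
Local Notation R0 := (supp_space F QG).
(** [R0] is the image of u |-> u^Q; its a-component is a copy of the residue field of the chain ring
    aR. *)
Definition atom_dim a := \dim (mulv (val a) @: R0).
Local Notation d := atom_dim.

Lemma Q_gt1 : (1 < Q)%N.
Proof. by rewrite -(exp1n D) ltn_exp2r // card_finNzRing_gt1. Qed.

Lemma pi_N : pi ^+ N = 0.
Proof.
have := FG_exprDn p_prime cardF k pi 1; rewrite subrK expr1n gmonX mulz_N.
by move/esym/(canRL (addrK _)) ->; apply: subrr.
Qed.

Lemma mem_R0 u : u ^+ Q \in R0.
Proof.
rewrite (FG_frobenius p_prime cardF); apply: memv_suml => g _.
by rewrite memvZ // memv_span // map_f // mem_enum; apply: imset_f.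
Qed.

Lemma R0_fix u : u \in R0 -> u ^+ Q = u.
Proof.
move/mem_supp_spaceP=> uR0.
rewrite (FG_frobenius p_prime cardF) [RHS]ga_sumE; apply: eq_bigr => g _.
have [/imsetP[h _ ->]|gQ] := boolP (g \in QG); first by rewrite mulQ_idem.
by rewrite uR0 // !scale0r.
Qed.

Lemma expQ_idem u : u ^+ Q ^+ Q = u ^+ Q.
Proof. exact/R0_fix/mem_R0. Qed.

Lemma idem_exp (e : FG) n : e * e = e -> e ^+ n.+1 = e.
Proof. by move=> ee; elim: n => [|n IHn]; rewrite ?expr1 // exprS IHn. Qed.

Lemma atomX a n : val a ^+ n.+1 = val a.
Proof. exact/idem_exp/atomM. Qed.

Lemma atom_R0 a : val a \in R0.
Proof. by rewrite -(atomX a Q.-1) prednK ?mem_R0 // ltnW // Q_gt1. Qed.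

Lemma sub_expQ u : exists w, u - u ^+ Q = pi * w.
Proof.
rewrite (FG_frobenius p_prime cardF) {1}[u]ga_sumE -sumrB.
apply: (big_ind (fun v => exists w, v = pi * w)) => [|_ _ [v ->] [w ->]|g _].
- by exists 0; rewrite mulr0.
- by exists (v + w); rewrite mulrDr.
have [t gE] := G_gen g; rewrite -scalerBr {2}gE gmonD -{2}[gmon F (g *+ Q)]mulr1.
rewrite -mulrBr -(gmonX F z) subrX1 mulrCA scalerAr; eexists; reflexivity.
Qed.

(** With r = u^Q one has r^Q = r, so r^(Q-1) is idempotent and primitivity of a leaves two cases. *)
Lemma atom_expQ a u : val a * u ^+ Q = 0 \/ exists w, val a * u * w = val a.
Proof.
have QE : Q = (Q - 2).+2 by rewrite -addn2 subnK // Q_gt1.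
set r := u ^+ Q; have rQ : r ^+ Q = r by apply: expQ_idem.
have [] := @atom_idem F G a (r ^+ (Q - 2).+1).
- by rewrite -exprD addnS -addSn -QE exprD rQ -exprS.
- move=> r0; left; rewrite -rQ QE exprSr mulrA r0 mul0r //.
move=> rE; right; exists (u ^+ (Q - 1) * r ^+ (Q - 2)).
rewrite -mulrA [u * _]mulrA -exprS -[(Q - 1).+1]addn1 subnK ?(ltnW Q_gt1) //.
by rewrite -/r -exprS.
Qed.

(** A cofactor w that is not a unit in the component has a w^Q = 0, and w - w^Q is a multiple of
    [pi], so one more factor [pi] splits off; [pi_N] ends this at exponent N. *)
Lemma atom_chain a u : exists j, exists w, exists w',
  [/\ (j <= N)%N, val a * u = val a * pi ^+ j * w & val a * w * w' = val a].
Proof.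
suff step n : (exists j, exists w, exists w',
    [/\ (j < n)%N, val a * u = val a * pi ^+ j * w & val a * w * w' = val a])
  \/ exists w, val a * u = val a * pi ^+ n * w.
  have [[j [w [w' [jN uE wE]]]]|[w uE]] := step N.
    by exists j, w, w'; split=> //; apply: ltnW.
  exists N, 1, 1; split=> //; last by rewrite !mulr1.
  by rewrite uE pi_N mulr0 !mul0r.
elim: n => [|n [[j [w [w' [jn uE wE]]]]|[w uE]]].
- by right; exists u; rewrite mulr1.
- by left; exists j, w, w'; split=> //; apply: ltnW.
have [w0|[w' wE]] := atom_expQ a w; last by left; exists n, w, w'; split.
have [v vE] := sub_expQ w; right; exists v.
rewrite uE exprSr -!mulrA -vE mulrBr mulrBr.
by rewrite [X in _ - X]mulrCA w0 mulr0 subr0.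
Qed.


Lemma mem_P a j u : reflect (exists v, u = val a * pi ^+ j * v) (u \in P a j).
Proof. exact: mem_limg_mulv. Qed.

Lemma P_atom a j u : u \in P a j -> val a * u = u.
Proof. by case/mem_P=> v ->; rewrite -mulrA atomMl. Qed.

Lemma P_M a j u v : u \in P a j -> u * v \in P a j.
Proof. by case/mem_P=> w ->; apply/mem_P; exists (w * v); rewrite mulrA. Qed.

Lemma P_anti a i j : (i <= j)%N -> (P a j <= P a i)%VS.
Proof.
move=> ij; apply/subvP=> _ /mem_P[w ->]; apply/mem_P.
by exists (pi ^+ (j - i) * w); rewrite -(subnKC ij) exprD addKn !mulrA.
Qed.

Lemma P_N a : P a N = 0%VS.
Proof.
apply/eqP; rewrite -subv0; apply/subvP => _ /mem_P[w ->].
by rewrite pi_N mulr0 mul0r mem0v.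
Qed.

Lemma sum_atom_dim : (\sum_a d a)%N = #|QG|.
Proof.
rewrite -(dim_supp_space F) -dim_sum_atom => [|a _ /memv_imgP[u _ ->]]; last first.
  by rewrite mulvE atomMl.
congr (\dim _); apply/eqP; rewrite eqEsubv; apply/andP; split.
  apply/subv_sumP => a _; apply/subvP => _ /memv_imgP[u uR0 ->].
  have /R0_fix uE := uR0; rewrite mulvE -uE -[val a](R0_fix (atom_R0 a)).
  by rewrite -exprMn mem_R0.
apply/subvP => u uR0; rewrite [u]atom_decomp; apply: memv_sumr => a _.
by rewrite -mulvE memv_img.
Qed.

(** Modulo [pi] every u equals u^Q, which lies in [R0]; hence [pi ^+ j] times the a-component of
    [R0] spans the quotient of consecutive powers. *)
Lemma dim_P_step a j : (\dim (P a j) <= d a + \dim (P a j.+1))%N.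
Proof.
have sub : (P a j <= mulv (pi ^+ j) @: (mulv (val a) @: R0) + P a j.+1)%VS.
  apply/subvP => _ /mem_P[u ->]; have [w uE] := sub_expQ u.
  rewrite -[u](subrK (u ^+ Q)) uE mulrDr addrC; apply: memv_add.
    rewrite [val a * _]mulrC -mulrA -mulvE memv_img // -mulvE memv_img //.
    exact: mem_R0.
  by apply/mem_P; exists w; rewrite mulrA -(mulrA (val a)) -exprSr.
apply: leq_trans (dimvS sub) (leq_trans (dimv_add_leqif _ _) _).
rewrite leq_add2r /atom_dim.
by rewrite -(limg_ker_dim (mulv (pi ^+ j)) (mulv (val a) @: R0)) leq_addl.
Qed.

Lemma dim_P0_le a j : (\dim (P a 0) <= j * d a + \dim (P a j))%N.
Proof.
elim: j => // j IHj; apply: leq_trans IHj _.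
by rewrite mulSn -addnA addnCA leq_add2l dim_P_step.
Qed.

Lemma dim_P_le a j : (j <= N)%N -> (\dim (P a j) <= (N - j) * d a)%N.
Proof.
move=> jN; rewrite -{1}(subKn jN); elim: (N - j)%N (leq_subr j N) => [|n IHn] nN.
  by rewrite subn0 P_N dimv0.
apply: leq_trans (dim_P_step _ _) _; rewrite mulSn leq_add2l subnSK //.
exact/IHn/ltnW.
Qed.

Lemma sum_dim_P0 : (\sum_(a : atom) \dim (P a 0))%N = #|G|.
Proof.
rewrite -(dim_FG F) -dim_sum_atom => [|a u /P_atom//].
congr (\dim _); apply/eqP; rewrite eqEsubv subvf; apply/subvP => u _.
rewrite [u]atom_decomp; apply: memv_sumr => a _.
by apply/mem_P; exists u; rewrite mulr1.
Qed.

(** The upper bounds at j = 0 sum over all a to N |QG| = |G|, the true dimension, so none is strict;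
    this propagates to every j. *)
Lemma dim_P a j : (j <= N)%N -> \dim (P a j) = ((N - j) * d a)%N.
Proof.
have le b : (\dim (P b 0) <= N * d b)%N.
  by have := @dim_P_le b 0; rewrite subn0; apply.
have P0 : \dim (P a 0) = (N * d a)%N.
  apply/eqP; rewrite eqn_leq le /= leqNgt; apply/negP => lt.
  suff : (\sum_(b : atom) \dim (P b 0) < \sum_(b : atom) N * d b)%N.
    by rewrite sum_dim_P0 -big_distrr /= sum_atom_dim -card_G ltnn.
  rewrite (bigD1 a) //= [X in (_ < X)%N](bigD1 a) //= -addSn.
  by apply: leq_add => //; apply: leq_sum => b _; apply: le.
move=> jN; apply/eqP; rewrite eqn_leq dim_P_le //=.
by have := dim_P0_le a j; rewrite P0 mulnBl leq_subLR.
Qed.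

Lemma atom_dim_gt0 a : (0 < d a)%N.
Proof.
rewrite lt0n dimv_eq0; apply: contra (atom_neq0 a) => /eqP d0.
by rewrite -memv0 -d0 -{1}(atomM a) -mulvE memv_img ?atom_R0.
Qed.

Lemma P_subE a i j : (i <= N)%N -> (j <= N)%N -> (P a i <= P a j)%VS = (j <= i)%N.
Proof.
move=> iN jN; apply/idP/idP => [/dimvS|]; last exact: P_anti.
by rewrite !dim_P // leq_pmul2r ?atom_dim_gt0 // leq_sub2lE.
Qed.

Lemma mem_P_pi a i j : (i <= N)%N -> (j <= N)%N ->
  (val a * pi ^+ i \in P a j) = (j <= i)%N.
Proof.
move=> iN jN; rewrite -(P_subE a iN jN); apply/idP/subvP => [iP _ /mem_P[w ->]|].
  exact: P_M.
by apply; apply/mem_P; exists 1; rewrite mulr1.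
Qed.

Lemma atom_pi_eq0 a j : (val a * pi ^+ j == 0) = (N <= j)%N.
Proof.
have [jN|jN] := leqP j N; first by rewrite -(mem_P_pi a jN (leqnn N)) P_N memv0.
rewrite (ltnW jN); apply/eqP; rewrite -(subnKC (ltnW jN)) exprD pi_N.
by rewrite mul0r mulr0.
Qed.

Lemma atom_chain_mem a u : exists2 j, (j <= N)%N &
  exists w, exists w',
    val a * u = val a * pi ^+ j * w /\ val a * pi ^+ j = val a * u * w'.
Proof.
have [j [w [w' [jN uE wE]]]] := atom_chain a u; exists j => //; exists w, w'.
by split=> //; rewrite uE -{1}wE mulrAC (mulrAC (val a)).
Qed.


(** * Codes as exponent functions; their duals and hulls *)

Local Notation index := {ffun atom -> 'I_N.+1}.
Implicit Types (i : index).

Definition chain_ideal i := (\sum_a P a (i a))%VS.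

Lemma mem_chain_ideal i u :
  reflect (forall a, val a * u \in P a (i a)) (u \in chain_ideal i).
Proof.
apply: (iffP idP) => [/memv_sumP[us usP ->] a|uP]; last first.
  by rewrite [u]atom_decomp; apply: memv_sumr => a _.
rewrite mulr_sumr (bigD1 a) //= (P_atom (usP a isT)) big1 ?addr0 ?usP // => b ba.
by rewrite -(P_atom (usP b isT)) mulrA atom_ortho ?mul0r // eq_sym.
Qed.

Definition chain_code i : {set FG} := [set u | u \in chain_ideal i].

Lemma mem_chain_code i u :
  reflect (forall a, val a * u \in P a (i a)) (u \in chain_code i).
Proof. by rewrite inE; apply: mem_chain_ideal. Qed.

Lemma atom_pi_code i a j : (j <= N)%N ->
  (val a * pi ^+ j \in chain_code i) = (i a <= j)%N.
Proof.
move=> jN; have iN : (i a <= N)%N by rewrite -ltnS.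
rewrite -(mem_P_pi a jN iN); apply/mem_chain_code/idP => [/(_ a)|aP b].
  by rewrite atomMl.
have [->|ba] := eqVneq b a; first by rewrite atomMl.
by rewrite mulrA atom_ortho // mul0r mem0v.
Qed.

Lemma chain_code_ideal i : chain_code i \in abelian_codes F G.
Proof.
apply/abelian_codesP; split=> [|u v /mem_chain_code uP /mem_chain_code vP|u v].
- by apply/mem_chain_code => a; rewrite mulr0 mem0v.
- by apply/mem_chain_code => a; rewrite mulrDr memvD.
move/mem_chain_code=> vP; apply/mem_chain_code => a.
by rewrite [u * v]mulrC mulrA P_M.
Qed.

Lemma chain_code_inj : injective chain_code.
Proof.
have le i j a : chain_code i = chain_code j -> (i a <= j a)%N.
  have jN : (j a <= N)%N by rewrite -ltnS.
  by move=> ij; rewrite -(atom_pi_code i a jN) ij atom_pi_code.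
by move=> i j ij; apply/ffunP => a; apply/val_inj/anti_leq; rewrite !le.
Qed.

Lemma chain_code_surj C : C \in abelian_codes F G -> exists i, C = chain_code i.
Proof.
move=> CC; have [C0 CD CM] := abelian_codesP _ CC.
(* The exponent at a is the least power of [pi] whose a-component lies in C. *)
have ex a : exists j, val a * pi ^+ j \in C by exists N; rewrite pi_N mulr0.
pose m a := ex_minn (ex a).
have m_le a : (m a <= N)%N.
  by rewrite /m; case: ex_minnP => j _; apply; rewrite pi_N mulr0.
have mC a : val a * pi ^+ m a \in C by rewrite /m; case: ex_minnP.
have m_min a j : val a * pi ^+ j \in C -> (m a <= j)%N.
  by rewrite /m; case: ex_minnP => ? _; apply.
exists [ffun a => inord (m a)]; apply/setP => u; apply/idP/mem_chain_code.
  move=> uC a; rewrite ffunE inordK ?ltnS //.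
  have [j _ [w [w' [uE piE]]]] := atom_chain_mem a u.
  rewrite uE; apply: P_M; apply: (subvP (P_anti a (m_min a j _))).
    by rewrite piE mulrC mulrA CM.
  by apply/mem_P; exists 1; rewrite mulr1.
move=> uP; rewrite [u]atom_decomp; apply: (big_ind (fun v => v \in C)) => // a _.
have := uP a; rewrite ffunE inordK ?ltnS // => /mem_P[w ->].
by rewrite mulrC CM.
Qed.

Lemma star_pi : exists w, star pi = w * pi.
Proof.
exists (- gmon F (- z)); rewrite mulNr mulrBr mulr1 -gmonD addNr opprB.
rewrite (starD (gmon F z)) star_gmon; congr (_ + _).
by rewrite -[-1]scaleN1r starZ star1 scaleN1r.
Qed.

Lemma star_pi_inv : exists w, star pi * w = pi.
Proof.
have [w piE] := star_pi; exists (star w).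
by rewrite mulrC -starM -piE starK.
Qed.


Definition dual_index i : index := [ffun a => inord (N - i (starT a))].

Lemma dual_indexE i a : dual_index i a = (N - i (starT a))%N :> nat.
Proof. by rewrite ffunE inordK // ltnS leq_subr. Qed.

Lemma dual_chain_code i : dual (chain_code i) = chain_code (dual_index i).
Proof.
have iN a : (i a <= N)%N by rewrite -ltnS.
apply/setP => v.
apply/(dual_codeP _ (chain_code_ideal i))/mem_chain_code => [iv a|vP].
  (* Testing v against the generator at [starT a] shows that [pi ^+ i (starT a)] annihilates the
     a-component of v, whose exponent is therefore at least [N - i (starT a)]. *)
  have /iv : val (starT a) * pi ^+ i (starT a) \in chain_code i.
    by rewrite atom_pi_code.
  rewrite starM starX /= starK; have [w wE] := star_pi_inv.
  move/(congr1 ( *%R^~ (w ^+ i (starT a)))); rewrite mul0r mulrAC -(mulrA (val a)).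
  rewrite -exprMn wE mulrAC => av0.
  rewrite dual_indexE; have [j jN [x [x' [uE piE]]]] := atom_chain_mem a v.
  rewrite uE; apply: P_M; rewrite mem_P_pi ?leq_subr // leq_subLR.
  by rewrite -(atom_pi_eq0 a) exprD mulrCA piE mulrA [pi ^+ _ * _]mulrC av0 mul0r.
move=> c /mem_chain_code cP; apply: atom_ext => a; rewrite mulr0.
have /mem_P[w cE] := cP (starT a); have /mem_P[x vE] := vP a.
have acE : val a * star c = star (val (starT a) * c) by rewrite starM /= starK.
rewrite -atomMl (mulrCA (val a) (star c)) (mulrA _ (star c)).
rewrite acE vE cE !starM starX /= starK dual_indexE.
have [y ->] := star_pi; set n := i _; rewrite exprMn.
have pi0 : pi ^+ n * pi ^+ (N - n) = 0 by rewrite -exprD subnKC ?pi_N ?iN.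
move: pi0; set s := pi ^+ n; set t := pi ^+ (N - n); move: s t => s t st0.
rewrite (mulrC (y ^+ n)) (mulrCA (val a)) -(mulrA s) (mulrAC _ t x) (mulrC _ t).
by rewrite mulrACA st0 mul0r.
Qed.

Definition hull_index i : index :=
  [ffun a => inord (maxn (i a) (N - i (starT a)))].

Lemma hull_indexE i a : hull_index i a = maxn (i a) (N - i (starT a)) :> nat.
Proof. by rewrite ffunE inordK // ltnS geq_max leq_subr -ltnS ltn_ord. Qed.

Lemma hull_chain_code i : hull (chain_code i) = chain_code (hull_index i).
Proof.
have sub (j l : index) : (forall a, (j a <= l a)%N) ->
    chain_code l \subset chain_code j.
  move=> jl; apply/subsetP => u /mem_chain_code uP; apply/mem_chain_code => a.
  exact: subvP (P_anti a (jl a)) _ (uP a).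
rewrite /hull dual_chain_code; apply/eqP; rewrite eqEsubset subsetI.
apply/and3P; split; last 2 first.
- by apply: sub => a; rewrite hull_indexE leq_maxl.
- by apply: sub => a; rewrite hull_indexE dual_indexE leq_maxr.
apply/subsetP => u; rewrite inE => /andP[/mem_chain_code iu /mem_chain_code du].
apply/mem_chain_code => a; have := iu a; have := du a.
by rewrite hull_indexE dual_indexE /maxn; case: ifP.
Qed.

Lemma code_dim_chain_code i : code_dim (chain_code i) = (\sum_a (N - i a) * d a)%N.
Proof.
rewrite /code_dim (_ : <<enum (chain_code i)>>%VS = chain_ideal i).
  rewrite dim_sum_atom => [|a u]; last exact: P_atom.
  by apply: eq_bigr => a _; rewrite dim_P // -ltnS.
by apply/vspaceP => u; rewrite span_code ?chain_code_ideal // inE.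
Qed.

Lemma avg_hull_dim_chain : avg_hull_dim F G
  = (\sum_(i : index) \sum_a minn (N - i a) (i (starT a)) * d a)%N%:R / #|index|%:R.
Proof.
have codesE : abelian_codes F G = chain_code @: index.
  apply/setP => C; apply/idP/imsetP => [/chain_code_surj[i ->]|[i _ ->]].
    by exists i.
  exact: chain_code_ideal.
rewrite /avg_hull_dim codesE card_imset; last exact: chain_code_inj.
rewrite big_imset /=; last by move=> i j _ _; apply: chain_code_inj.
rewrite natr_sum; congr (_ / _); apply: eq_big => [i|i _]; first by rewrite inE.
rewrite hull_chain_code code_dim_chain_code; congr _%:R; apply: eq_bigr => a _.
have iN b : (i b <= N)%N by rewrite -ltnS.
rewrite hull_indexE; congr (_ * _)%N.
have [le|/ltnW le] := leqP (i a) (N - i (starT a)).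
  by rewrite subKn //; apply/esym/minn_idPr; rewrite leq_subCr.
by apply/esym/minn_idPl; rewrite leq_subCl.
Qed.

End ChainComponents.

(** * Averages of minima over exponent functions *)

(* Translating a tuple in some of its coordinates permutes the set of tuples. *)
Section Averaging.
Variables (T : finType) (n : nat).
Local Notation tuples := {ffun T -> 'I_n.+1}.

Let mul_ord c : (n.+1 * c = \sum_(x : 'I_n.+1) c)%N.
Proof. by rewrite sum_nat_const card_ord. Qed.

Lemma sum_ffun1 (a : T) (h : 'I_n.+1 -> nat) :
  (n.+1 * \sum_(i : tuples) h (i a) = #|tuples| * \sum_x h x)%N.
Proof.
have shift (x : 'I_n.+1) :
    (\sum_(i : tuples) h (i a) = \sum_(i : tuples) h (i a + x)%R)%N.
  rewrite (reindex_inj (addIr [ffun=> x])) /=; apply: eq_bigr => i _.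
  by rewrite !ffunE.
rewrite mul_ord (eq_bigr _ (fun x _ => shift x)) exchange_big /= -sum_nat_const.
by apply: eq_bigr => i _; rewrite [RHS](reindex_inj (addrI (i a))).
Qed.

Lemma sum_ffun2 (a b : T) (h : 'I_n.+1 -> 'I_n.+1 -> nat) : a != b ->
  (n.+1 * n.+1 * \sum_(i : tuples) h (i a) (i b)
    = #|tuples| * \sum_x \sum_y h x y)%N.
Proof.
move=> ab; have shift (x y : 'I_n.+1) : (\sum_(i : tuples) h (i a) (i b)
    = \sum_(i : tuples) h (i a + x)%R (i b + y)%R)%N.
  rewrite (reindex_inj (addIr [ffun c => if c == a then x else y])) /=.
  by apply: eq_bigr => i _; rewrite !ffunE eqxx eq_sym (negPf ab).
have -> : (n.+1 * n.+1 * \sum_(i : tuples) h (i a) (i b)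
    = \sum_x \sum_y \sum_(i : tuples) h (i a + x)%R (i b + y)%R)%N.
  rewrite -mulnA mul_ord; apply: eq_bigr => x _.
  by rewrite mul_ord; apply: eq_bigr => y _; apply: shift.
under eq_bigr => x _ do rewrite exchange_big /=.
rewrite exchange_big /= -sum_nat_const; apply: eq_bigr => i _.
rewrite [RHS](reindex_inj (addrI (i a))); apply: eq_bigr => x _.
by rewrite [RHS](reindex_inj (addrI (i b))).
Qed.

End Averaging.

Lemma sum_minn_rev n : (\sum_(x < n.+1) \sum_(y < n.+1) minn (n - x) y
  = \sum_(x < n.+1) \sum_(y < n.+1) minn x y)%N.
Proof.
rewrite (reindex_inj rev_ord_inj) /=; apply: eq_bigr => x _.
by apply: eq_bigr => y _; rewrite subSS subKn // -ltnS.
Qed.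

(** Exactly (n+1-t)^2 pairs have minimum at least t, so this is the sum of the first n squares; the
    induction peels off the last row and column. *)
Lemma sum_minnE n : (6 * \sum_(x < n.+1) \sum_(y < n.+1) minn x y
  = n * n.+1 * (2 * n).+1)%N.
Proof.
elim: n => [|n IHn]; first by rewrite !big_ord1 minnn.
have sum_id : (2 * \sum_(y < n.+1) y = n * n.+1)%N.
  by elim: (n) => [|l IHl]; rewrite ?big_ord1 // big_ord_recr mulnDr IHl /=; ring.
have last_row : (\sum_(y < n.+2) minn n.+1 y = \sum_(y < n.+1) y + n.+1)%N.
  rewrite big_ord_recr /= minnn; congr (_ + _)%N; apply: eq_bigr => y _.
  by rewrite (minn_idPr _) // ltnW.
have rows : (\sum_(x < n.+1) \sum_(y < n.+2) minn x y
    = \sum_(x < n.+1) \sum_(y < n.+1) minn x y + \sum_(x < n.+1) x)%N.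
  rewrite -big_split; apply: eq_bigr => x _; rewrite big_ord_recr /=.
  by rewrite (minn_idPl _) // ltnW.
by rewrite big_ord_recr /= last_row rows; move: IHn sum_id; lia.
Qed.

Lemma sum_minn_off n : (0 < n)%N ->
  (3 * \sum_(x < n.+1) \sum_(y < n.+1) minn (n - x) y < n * (n.+1 * n.+1))%N.
Proof.
by rewrite sum_minn_rev => n_gt0; have := sum_minnE n; nia.
Qed.

Lemma sum_minn_diag_le n : (4 * \sum_(x < n.+1) minn (n - x) x <= n * n)%N.
Proof.
(* Removing both end terms, which vanish, passes from n + 2 to n, so the induction carries two
   consecutive cases. *)
suff: (4 * \sum_(x < n.+1) minn (n - x) x <= n * n)%N /\
      (4 * \sum_(x < n.+2) minn (n.+1 - x) x <= n.+1 * n.+1)%N by case.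
elim: n => [|n [IHn IHn1]]; first by rewrite !big_ord_recl !big_ord0.
split=> //; rewrite big_ord_recl minn0 big_ord_recr /= !subSS subnn min0n addn0.
rewrite (eq_bigr (fun x : 'I_n.+1 => 1 + minn (n - x) x)%N) => [|x _]; last first.
  by rewrite /bump /= subSS subSn ?minnSS // -ltnS.
rewrite big_split /= sum1_card card_ord; move: IHn.
by set S := (\sum_(_ < _) _)%N; nia.
Qed.

Lemma sum_minn_diag n : (0 < n)%N ->
  (3 * \sum_(x < n.+1) minn (n - x) x < n * n.+1)%N.
Proof. by have := sum_minn_diag_le n; nia. Qed.

(** * The average hull dimension *)

Section HullSums.
Variables (p nu k D : nat) (F : finFieldType) (G : finZmodType) (z : G).
Local Notation FG := (group_algebra F G).
Local Notation Q := (#|F| ^ D)%N.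
Local Notation N := (p ^ k)%N.
Local Notation QG := [set g *+ Q | g : G].
Hypotheses (p_prime : prime p) (cardF : #|F| = (p ^ nu)%N) (D_gt0 : (0 < D)%N).
Hypothesis mulQ_idem : forall g : G, g *+ Q *+ Q = g *+ Q.
Hypothesis mulz_N : z *+ N = 0.
Hypothesis G_gen : forall g : G, exists t, g = g *+ Q + z *+ t.
Hypothesis card_G : #|G| = (N * #|QG|)%N.
Local Notation atom := {e : FG | primitive_idempotent e}.
Local Notation d := (@atom_dim D F G).
Local Notation index := {ffun atom -> 'I_N.+1}.
Local Notation S a := (\sum_(i : index) minn (N - i a) (i (starT a)))%N.

Lemma avg_hull_dimE :
  avg_hull_dim F G = (\sum_(a : atom) S a * d a)%N%:R / #|index|%:R.
Proof.
rewrite (avg_hull_dim_chain p_prime cardF D_gt0 mulQ_idem mulz_N G_gen card_G).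
by rewrite exchange_big; congr (_%:R / _); apply: eq_bigr => a _; rewrite big_distrl.
Qed.

Lemma card_index_gt0 : (0 < #|index|)%N.
Proof. by rewrite card_ffun card_ord expn_gt0. Qed.

Lemma atom_hull_sum_lt (a : atom) : (3 * S a < N * #|index|)%N.
Proof.
have N_gt0 : (0 < N)%N by rewrite expn_gt0 prime_gt0.
have [ab|/eqP ab] := eqVneq (starT a) a.
  have := sum_ffun1 a (fun x : 'I_N.+1 => minn (N - x) x); rewrite ab.
  have := sum_minn_diag N_gt0; have := card_index_gt0.
  move: (\sum_x _)%N (\sum_(i : index) _)%N #|index| => s t c; nia.
have := sum_ffun2 (fun x y : 'I_N.+1 => minn (N - x) y) (introN eqP (nesym ab)).
have := sum_minn_off N_gt0; have := card_index_gt0.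
move: (\sum_x _)%N (\sum_(i : index) _)%N #|index| => s t c; nia.
Qed.

Lemma avg_hull_dim_lt : avg_hull_dim F G < #|G|%:R / 3%:R.
Proof.
have c_gt0 := card_index_gt0.
have sum_d := sum_atom_dim p_prime cardF D_gt0 mulQ_idem.
have Q_gt0 : (0 < #|QG|)%N by apply/card_gt0P; exists (0 *+ Q); apply: imset_f.
rewrite avg_hull_dimE ltr_pdivrMr ?ltr0n // mulrAC ltr_pdivlMr ?ltr0n //.
rewrite -!natrM ltr_nat card_G -sum_d mulnAC.
(* The successor keeps the strict bound: after summation it leaves a gap of |QG| > 0. *)
have : (\sum_(a : atom) (3 * S a).+1 * d a <= \sum_(a : atom) N * #|index| * d a)%N.
  by apply: leq_sum => a _; rewrite leq_mul2r atom_hull_sum_lt orbT.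
rewrite -big_distrr /=; apply: leq_trans.
under [X in (_ < X)%N]eq_bigr => a _ do rewrite mulSn -mulnA.
by rewrite big_split /= -big_distrr /= sum_d mulnC -[ltnLHS]add0n ltn_add2r.
Qed.

Lemma avg_hull_dim_semisimple : N = 1 ->
  avg_hull_dim F G = (\sum_(a : atom | starT a != a) d a)%N%:R / 4%:R.
Proof.
move=> N1; have c_gt0 := card_index_gt0.
rewrite avg_hull_dimE; apply/eqP.
rewrite eqr_div ?pnatr_eq0 -?lt0n // -!natrM eqr_nat.
rewrite [X in (_ == X * _)%N]big_mkcond /=.
rewrite !big_distrl /=; apply/eqP; apply: eq_bigr => a _.
case: (eqVneq (starT a) a) => [ab|/eqP ab].
  have := sum_ffun1 a (fun x : 'I_N.+1 => minn (N - x) x); rewrite ab.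
  rewrite [X in _ = (_ * X)%N](_ : _ = 0)%N; last first.
    by rewrite N1 !big_ord_recl big_ord0.
  by rewrite muln0 => /eqP; rewrite muln_eq0 /= => /eqP->.
have := sum_ffun2 (fun x y : 'I_N.+1 => minn (N - x) y) (introN eqP (nesym ab)).
rewrite [X in _ = (_ * X)%N](_ : _ = 1)%N; last first.
  by rewrite N1 !big_ord_recl !big_ord0.
rewrite muln1 {1 2}N1.
move: (\sum_(i : index) _)%N #|index| => t c /=; nia.
Qed.

End HullSums.

(** * Counting by fibers, gcd-closed predicates, independence of characters *)

Lemma card_fibers (T U : finType) (r : T -> U) c :
  (forall x, #|[set y | r y == r x]| = c) -> #|T| = (#|r @: T| * c)%N.
Proof.
move=> rc; rewrite -[LHS]sum1_card -sum_nat_const.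
rewrite (partition_big r [in r @: T]) => [|x _]; last exact: imset_f.
apply: eq_bigr => _ /imsetP[x _ ->].
by rewrite sum1dep_card -(rc x); apply: eq_card => y; rewrite !inE.
Qed.

Lemma gcdn_closed (Pr : pred nat) n j : Pr 0%N ->
  (forall x y, Pr x -> Pr (x + y)%N = Pr y) -> Pr (gcdn n j) = Pr n && Pr j.
Proof.
move=> P0 PD; have PM x y : Pr x -> Pr (y * x)%N.
  by move=> Px; elim: y => // y IHy; rewrite mulSn PD.
apply/idP/andP => [Pg|[Pn Pj]].
  by split; [have /dvdnP[x ->] := dvdn_gcdl n j | have /dvdnP[x ->] := dvdn_gcdr n j];
    apply: PM.
have [->|n_gt0] := posnP n; first by rewrite gcd0n.
case: (egcdnP j n_gt0) => x y e _.
by rewrite -(PD (y * j)%N) ?PM // -e PM.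
Qed.

(* Artin's independence of characters: subtracting [chi i h] times the relation *)
(* from its translate by [h] removes [chi i].                                   *)
Lemma character_independence (R : comNzRingType) (B : zmodType) (I : eqType)
    (e : R) (chi : I -> B -> R) (i0 : I) (s : seq I) (c0 : R) (c : I -> R) :
  (forall u v, e * u != 0 -> e * (u * v) = 0 -> e * v = 0) ->
  (forall i g h, chi i (g + h) = chi i g * chi i h) -> (forall i, chi i 0 = 1) ->
  {in s, forall i, exists g, e * (chi i0 g - chi i g) != 0} ->
  (forall g, e * (c0 * chi i0 g + \sum_(i <- s) c i * chi i g) = 0) ->
  e * c0 = 0.
Proof.
move=> e_dom chiD chi0; elim: s c0 c => [|i s IHs] c0 c sep rel.
  by have := rel 0; rewrite big_nil addr0 chi0 mulr1.
have [h eh] := sep i (mem_head i s); apply: (e_dom _ _ eh).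
apply: (IHs _ (fun l => c l * (chi l h - chi i h))) => [l ls|g].
  by apply: sep; rewrite inE ls orbT.
transitivity (e * (c0 * chi i0 (g + h) + \sum_(l <- i :: s) c l * chi l (g + h))
    - chi i h * (e * (c0 * chi i0 g + \sum_(l <- i :: s) c l * chi l g))).
  rewrite !big_cons !chiD.
  have -> : \sum_(l <- s) c l * (chi l h - chi i h) * chi l g
      = \sum_(l <- s) c l * chi l (g + h) - chi i h * \sum_(l <- s) c l * chi l g.
    by rewrite mulr_sumr -sumrB; apply: eq_bigr => l _; rewrite chiD; ring.
  ring.
by rewrite !rel mulr0 subrr.
Qed.

(** * The semisimple case: components fixed by star *)

Section Semisimple.
Variables (p nu D : nat) (F : finFieldType) (A : finZmodType).
Local Notation FA := (group_algebra F A).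
Local Notation q := #|F|.
Hypotheses (p_prime : prime p) (cardF : q = (p ^ nu)%N) (D_gt0 : (0 < D)%N).
Hypothesis mulQ : forall g : A, g *+ (q ^ D) = g.
Local Notation atom := {e : FA | primitive_idempotent e}.
Local Notation d := (@atom_dim D F A).
Implicit Types (a : atom) (u v w : FA) (g h : A) (n j : nat).

Lemma expQ u : u ^+ (q ^ D) = u.
Proof.
rewrite (FG_frobenius p_prime cardF) [RHS]ga_sumE.
by apply: eq_bigr => g _; rewrite mulQ.
Qed.

(** Here u^Q = u, so [atom_expQ] says that every component is a field. *)
Lemma atom_unit a u : val a * u != 0 -> exists w, val a * u * w = val a.
Proof.
have mulQ_idem g : g *+ (q ^ D) *+ (q ^ D) = g *+ (q ^ D) by rewrite !mulQ.
have [|//] := atom_expQ p_prime cardF D_gt0 mulQ_idem a u.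
by rewrite expQ => ->; rewrite eqxx.
Qed.

Lemma atom_mul_eq0 a u v : val a * u != 0 -> val a * (u * v) = 0 -> val a * v = 0.
Proof.
move=> /atom_unit[w wE] uv0.
by rewrite -wE -mulrA (mulrC w) mulrA -(mulrA (val a)) uv0 mul0r.
Qed.

Lemma atom_dim_full a : d a = \dim (limg (mulv (val a))).
Proof.
rewrite /atom_dim; congr (\dim (_ @: _)).
apply/vspaceP => u; rewrite memvf; apply/mem_supp_spaceP => g.
by case/negP; apply/imsetP; exists g; rewrite ?mulQ.
Qed.

Definition torsion_atom n a : bool :=
  [forall g : A, val a * gmon F (g *+ n) == val a].
Local Notation X := torsion_atom.

Lemma torsion_atomP n a :
  reflect (forall g, val a * gmon F (g *+ n) = val a) (X n a).
Proof. exact: 'forall_eqP. Qed.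

Section Invariants.
Variable n : nat.
Local Notation nA := [set g *+ n | g : A].

Let nA_D x y : x \in nA -> y \in nA -> x + y \in nA.
Proof.
by move=> /imsetP[g _ ->] /imsetP[h _ ->]; rewrite -mulrnDl; apply: imset_f.
Qed.

Let nA_N x : x \in nA -> - x \in nA.
Proof. by move=> /imsetP[g _ ->]; rewrite -mulNrn; apply: imset_f. Qed.

Let nA_0 : 0 \in nA.
Proof. by rewrite -(mul0rn _ n); apply: imset_f. Qed.

(** A coset representative modulo nA: [pick] depends only on the coset, and its default is never
    reached because g itself qualifies. *)
Let rep g : A := odflt g [pick x | x - g \in nA].

Let rep_sub g : rep g - g \in nA.
Proof. by rewrite /rep; case: pickP => //= _; rewrite subrr nA_0. Qed.

Let rep_eq g h : (rep g == rep h) = (g - h \in nA).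
Proof.
apply/eqP/idP => [gh|gh].
  have -> : g - h = (rep h - h) - (rep g - g).
    by rewrite gh opprB [RHS]addrC addrA subrK.
  exact/nA_D/nA_N.
rewrite /rep (eq_pick (_ : (fun x => x - g \in nA) =1 (fun x => x - h \in nA))).
  case: pickP => [//|/(_ h)]; by rewrite subrr nA_0.
move=> x; apply/idP/idP => [xg|xh].
  by rewrite -(subrK g x) -addrA nA_D.
by rewrite -(subrK h x) -addrA -(opprB g h) nA_D ?nA_N.
Qed.

(** Extends values on the representatives to an nA-invariant function, identifying functions on A/nA
    with the invariants. *)
Let pull u : FA := mkga (fun g => coef u (rep g)).

Fact pull_linear : linear pull.
Proof. by move=> c u v; apply: gaP => g; rewrite [LHS]coefE !coefD !coefZ !coefE. Qed.

HB.instance Definition _ := GRing.isLinear.Build F FA FA _ pull pull_linear.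

Let S := rep @: A.

Let card_S : #|S| = #|[set g : A | g *+ n == 0]|.
Proof.
have nA_gt0 : (0 < #|nA|)%N by apply/card_gt0P; exists 0.
have fib_rep g : #|[set h | rep h == rep g]| = #|nA|.
  rewrite -[RHS](card_imset _ (addrI g)); apply: eq_card => h; rewrite inE rep_eq.
  apply/idP/imsetP => [hg|[x xnA ->]]; last by rewrite addrC addKr.
  by exists (h - g) => //; rewrite addrC subrK.
have fib_mul g : #|[set h : A | h *+ n == g *+ n]| = #|[set g : A | g *+ n == 0]|.
  rewrite -[RHS](card_imset _ (addrI g)); apply: eq_card => h; rewrite inE.
  rewrite -subr_eq0 -mulrnBl.
  apply/idP/imsetP => [hg|[x]]; last by rewrite inE => x0 ->; rewrite addrC addKr.
  by exists (h - g); rewrite ?inE // addrC subrK.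
apply/eqP; rewrite -(eqn_pmul2r nA_gt0).
have <- : #|A| = (#|S| * #|nA|)%N.
  exact: card_fibers.
by rewrite (card_fibers fib_mul) mulnC.
Qed.

Lemma sum_torsion_atom :
  (\sum_(a | X n a) d a)%N = #|[set g : A | g *+ n == 0]|.
Proof.
under eq_bigr => a _ do rewrite atom_dim_full.
rewrite -dim_sum_atom => [|a u /mem_limg_mulv[v ->]]; last by rewrite atomMl.
have dim_pull : \dim (linfun pull @: supp_space F S) = \dim (supp_space F S).
  apply: limg_dim_eq; apply/eqP; rewrite -subv0; apply/subvP => v.
  rewrite memv_cap memv_ker lfunE /=.
  case/andP=> /mem_supp_spaceP vS /eqP v0; rewrite memv0; apply/eqP/gaP => g.
  rewrite coef0; have [/imsetP[h _ ->]|/vS//] := boolP (g \in S).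
  by have := congr1 (fun w => coef w h) v0; rewrite coefE coef0.
rewrite -card_S -(dim_supp_space F) -dim_pull.
congr (\dim _); apply/eqP; rewrite eqEsubv; apply/andP; split.
  apply/subv_sumP => a /torsion_atomP aX; apply/subvP => _ /mem_limg_mulv[v ->].
  set u := _ * v; have uX g h : g - h \in nA -> coef u g = coef u h.
    case/imsetP=> x _ ghE; have -> : h = g - x *+ n by rewrite -ghE subKr.
    by rewrite -coef_gmonM /u mulrCA mulrA aX.
  move: u uX => u uX; apply/memv_imgP.
  exists (mkga (fun g => if g \in S then coef u g else 0)).
    by apply/mem_supp_spaceP => g /negPf gS; rewrite coefE gS.
  rewrite lfunE; apply: gaP => g; rewrite !coefE imset_f ?inE //.
  exact/esym/uX/rep_sub.
apply/subvP => _ /memv_imgP[v _ ->]; rewrite lfunE /=.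
rewrite [pull v]atom_decomp (bigID (X n)) /= addrC big1 => [|a].
  rewrite add0r; apply: memv_sumr => a _; apply/mem_limg_mulv; by exists (pull v).
(* On any other component some Y^(ng) - 1 is nonzero, hence invertible there, yet it annihilates the
   invariant [pull v]. *)
case/forallPn=> g ag; apply: (atom_mul_eq0 (u := gmon F (g *+ n) - 1)).
  by rewrite mulrBr mulr1 subr_eq0.
rewrite [X in _ * X](_ : _ = 0) ?mulr0 //.
apply: gaP => h; rewrite mulrBl mul1r coef0 -[- _]scaleN1r coefD coefZ coef_gmonM.
rewrite !coefE mulN1r; apply/eqP; rewrite subr_eq0; apply/eqP; congr coef.
apply/eqP; rewrite rep_eq addrAC subrr add0r nA_N //; exact: imset_f.
Qed.

End Invariants.

Lemma torsion_atom_gcd n j a : X (gcdn n j) a = X n a && X j a.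
Proof.
apply: (gcdn_closed (Pr := fun l => X l a)) => [|x y /torsion_atomP xa].
  by apply/torsion_atomP => g; rewrite mulr0n mulr1.
apply: eq_forallb => g.
by rewrite mulrnDr gmonD mulrA xa.
Qed.

Lemma torsion_gcd n j g : (g *+ gcdn n j == 0) = (g *+ n == 0) && (g *+ j == 0).
Proof.
apply: (gcdn_closed (Pr := fun l => g *+ l == 0)) => // x y /eqP gx.
by rewrite mulrnDr gx add0r.
Qed.

(** Inclusion-exclusion: on both sides, satisfying the condition for n and for j is the condition
    for gcd(n, j), so excluding j subtracts the count for the gcd from the count for n. *)
Lemma sum_torsion_free (s : seq nat) n :
  (\sum_(a | X n a && all (fun j => ~~ X j a) s) d a)%N
  = #|[set g : A | (g *+ n == 0) && all (fun j => g *+ j != 0) s]|.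
Proof.
elim: s n => [|j s IHs] n.
  rewrite (eq_bigl (X n)) => [|a]; last by rewrite andbT.
  by rewrite sum_torsion_atom; apply: eq_card => g; rewrite !inE andbT.
apply/eqP; rewrite -(eqn_add2l
  #|[set g : A | (g *+ gcdn n j == 0) && all (fun j => g *+ j != 0) s]|).
rewrite -{1}IHs; apply/eqP.
transitivity (\sum_(a | X n a && all (fun j => ~~ X j a) s) d a)%N.
  rewrite [RHS](bigID (X j)) /=; congr (_ + _)%N; apply: eq_bigl => a.
    by rewrite torsion_atom_gcd andbAC.
  by rewrite andbA andbAC.
rewrite IHs -(cardsID [set g : A | g *+ j == 0]); congr (_ + _)%N.
  by apply: eq_card => g; rewrite !inE torsion_gcd andbAC.
by apply: eq_card => g; rewrite !inE [RHS]andbCA.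
Qed.


(** u is a root of X^q - X, the product of all X - c, and in a field one factor must vanish. *)
Lemma atom_fixed a u : val a * u = u -> u ^+ q = u -> exists c : F, u = c *: val a.
Proof.
move=> au uq.
have prod0 : \prod_(c : F) (u - c%:A) = 0.
  have := congr1 (horner_alg u) (finField_genPoly F).
  rewrite rmorphB rmorphXn /= horner_algX uq subrr rmorph_prod => /= /esym.
  by under eq_bigr => c _ do rewrite rmorphB /= horner_algX horner_algC.
have [/existsP[c /eqP uc]|] := boolP [exists c : F, val a * (u - c%:A) == 0].
  exists c; move/eqP: uc; rewrite mulrBr au mulr_algr subr_eq0 => /eqP //.
rewrite negb_exists => /forallP none; case/negP: (atom_neq0 a).
apply/eqP; rewrite -[LHS]mulr1.
have : val a * \prod_(c : F) (u - c%:A) = 0 by rewrite prod0 mulr0.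
elim/big_rec: _ => // c v _ IHv acv.
by apply: IHv; apply: atom_mul_eq0 (none c) acv.
Qed.

(** On this component Y^(q^j g) agrees with Y^(-g), so star acts as a Frobenius power. The latter
    fixes a, hence a times star a is a, which orthogonality forbids for distinct idempotents. *)
Lemma starT_torsion_atom a j : X (q ^ j).+1 a -> starT a = a.
Proof.
move/torsion_atomP=> aX.
have aqj g : val a * gmon F (g *+ q ^ j) = val a * gmon F (- g).
  by rewrite -{2}(aX g) -mulrA -gmonD mulrS addrAC subrr add0r.
have astar u : val a * u ^+ (q ^ j) = val a * star u.
  rewrite (FG_frobenius p_prime cardF) [star u]ga_sumE.
  rewrite [X in _ = _ * X](reindex_inj oppr_inj) /=.
  rewrite !mulr_sumr; apply: eq_bigr => g _.
  by rewrite -!scalerAr aqj coefE opprK.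
have qj_gt0 : (0 < q ^ j)%N by rewrite expn_gt0 (ltnW (card_finNzRing_gt1 _)).
apply/eqP/negP => /negP sa; case/negP: (atom_neq0 a).
rewrite -{1}(atomM a) -{2}(atomX a (q ^ j).-1) prednK // astar.
by rewrite (atom_ortho (b := starT a)) // eq_sym.
Qed.

(** The equality of the traces of Y^g and Y^(-g) is a linear relation between the characters g |->
    Y^(q^j g) and g |-> Y^(-q^j g). If no q^j + 1 acted trivially, g |-> Y^(-g) would differ on the
    component from all the others, and independence would make a zero. *)
Lemma starT_fixedP a : starT a = a -> exists2 j, (j < D)%N & X (q ^ j).+1 a.
Proof.
move=> sa; pose period e := (0 < e)%N &&
  [forall g : A, val a * gmon F (g *+ q ^ e) == val a * gmon F g].
have ex : exists e, period e.
  by exists D; rewrite /period D_gt0; apply/forallP => g; rewrite mulQ.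
case: (ex_minnP ex) => e /andP[e_gt0 /'forall_eqP eP] e_min.
have eD : (e <= D)%N.
  apply: e_min; by rewrite /period D_gt0; apply/forallP => g; rewrite mulQ.
have [/existsP[j jX]|] := boolP [exists j : 'I_D, X (q ^ j).+1 a]; first by exists j.
rewrite negb_exists => /forallP none; case/negP: (atom_neq0 a); apply/eqP.
(* T g is the trace of f Y^g from fR to F f, so it is fixed by star. *)
pose T g := \sum_(j <- iota 0 e) val a * gmon F (g *+ q ^ j).
have q_gt0 : (0 < q)%N by rewrite ltnW // card_finNzRing_gt1.
have Tq g : T g ^+ q = T g.
  have expD : {morph (fun u : FA => u ^+ q) : u v / u + v}.
    by move=> u v; rewrite cardF (FG_exprDn p_prime cardF).
  have exp0 : (0 : FA) ^+ q = 0 by rewrite expr0n -leqn0 leqNgt q_gt0.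
  rewrite /T (big_morph _ expD exp0) -[e]subn0 -/(index_iota 0 e).
  rewrite (eq_bigr (fun j => val a * gmon F (g *+ q ^ j.+1))) => [|j _]; last first.
    by rewrite exprMn gmonX -mulrnA -expnSr -{1}(prednK q_gt0) atomX.
  by rewrite -(prednK e_gt0) big_nat_recr //= big_nat_recl //= prednK // eP addrC.
have Tstar g : star (T g) = T g.
  have [||c ->] := @atom_fixed a (T g).
  - by rewrite mulr_sumr; apply: eq_bigr => j _; rewrite atomMl.
  - exact: Tq.
  by rewrite starZ; congr (_ *: _); have := congr1 val sa.
pose chi (i : bool * nat) g := gmon F ((if i.1 then - g else g) *+ q ^ i.2).
rewrite -[LHS]mulr1.
pose s := [seq (true, j) | j <- iota 1 e.-1] ++ [seq (false, j) | j <- iota 0 e].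
apply: (@character_independence FA A _ (val a) chi (true, 0%N) s 1
          (fun i => if i.1 then 1 else -1)) => [u v||||].
- exact: atom_mul_eq0.
- by case=> -[] j g h; rewrite /chi /= -gmonD -mulrnDl // opprD.
- by case=> -[] j; rewrite /chi /= ?oppr0 mul0rn.
(* The characters with a minus sign are separated by minimality of the period e, those without by
   [none]. *)
- move=> i; rewrite mem_cat => /orP[] /mapP[j]; rewrite mem_iota => /andP[j1 je] ->.
    have /negP : ~~ period j.
      apply/negP => /e_min; rewrite leqNgt; case/negP.
      by move: je; rewrite add1n prednK.
    rewrite /period j1 /= => /negP/forallPn[g ag]; exists (- g).
    by rewrite /chi /= opprK mulr1n mulrBr subr_eq0 eq_sym.
  have /forallPn[g ag] := none (Ordinal (leq_trans je eD)); exists g.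
  apply: contra ag; rewrite /chi /= mulr1n mulrBr subr_eq0 => /eqP ag.
  by rewrite mulrS addrC gmonD mulrA -ag -mulrA -gmonD addNr mulr1.
move=> g; rewrite big_cat !big_map /= mul1r.
under eq_bigr => j _ do rewrite mul1r.
under [X in _ + (_ + X)]eq_bigr => j _ do rewrite mulN1r.
rewrite sumrN addrA mulrBr.
have <- : T g = val a * \sum_(j <- iota 0 e) chi (false, j) g by rewrite mulr_sumr.
apply/eqP; rewrite subr_eq0 -Tstar; apply/eqP.
rewrite /T (big_morph _ (@starD F A) (@star0 F A)) -{2}(prednK e_gt0) /= big_cons.
have starE j : star (val a * gmon F (g *+ q ^ j)) = val a * chi (true, j) g.
  by rewrite starM star_gmon /chi /= mulNrn; have /= -> := congr1 val sa.
by rewrite mulrDr mulr_sumr -starE; congr (_ + _); apply: eq_bigr => j _.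
Qed.

Lemma self_paired_free :
  [set g : A | all (fun j => g *+ j != 0) [seq (q ^ j).+1 | j <- iota 0 D]]
  = ~: self_paired A q.
Proof.
apply/setP => g; rewrite inE in_setC [X in ~~ X]inE all_map.
apply/allP/negP => [free /cyclotomicP[i gi]|nself].
  (* Exponents matter only modulo D, since q^D acts as the identity on A. *)
  have := free (i %% D)%N; rewrite mem_iota ltn_mod D_gt0 => /(_ isT) /eqP; apply.
  have modD l h : h *+ q ^ (l * D) = h.
    by elim: l h => [|l IHl] h; rewrite ?mulr1n // mulSn expnD mulrnA mulQ IHl.
  rewrite mulrS addrC -(modD (i %/ D)%N (g *+ _)) -mulrnA -expnD addnC -divn_eq.
  by rewrite -gi addNr.
move=> j _; apply/eqP => gj; apply/nself/cyclotomicP; exists j; apply/eqP.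
by rewrite -subr_eq0 -opprD oppr_eq0 -mulrS gj.
Qed.

Lemma sum_starT_moved :
  (\sum_(a : atom | starT a != a) d a + #|self_paired A q| = #|A|)%N.
Proof.
rewrite -(cardsC (self_paired A q)) addnC; congr (_ + _)%N.
rewrite -self_paired_free.
(* Taking n = 0 in [sum_torsion_free] imposes no torsion condition on either side. *)
transitivity (#|[set g : A | (g *+ 0 == 0) &&
    all (fun j => g *+ j != 0) [seq (q ^ j).+1 | j <- iota 0 D]]|); last first.
  by apply: eq_card => g; rewrite !inE mulr0n eqxx.
rewrite -sum_torsion_free; apply: eq_bigl => a.
have -> : X 0 a by apply/torsion_atomP => g; rewrite mulr0n mulr1.
rewrite all_map; apply/idP/allP => [sa j _|nX].
  by apply: contra sa => /starT_torsion_atom ->.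
apply/negP => /eqP/starT_fixedP[j jD]; apply/negP/nX.
by rewrite mem_iota.
Qed.

End Semisimple.

(** * Multiples in finite groups, and the three statements *)

Lemma finZmod_mulrn_card (A : finZmodType) (g : A) : g *+ #|A| = 0.
Proof.
have : \sum_(h : A) h = g *+ #|A| + \sum_(h : A) h.
  by rewrite {1}(reindex_inj (addrI g)) big_split sumr_const.
by rewrite -[LHS]add0r => /addIr <-.
Qed.

Lemma pair_mulrn (A B : zmodType) (a : A) (b : B) n : (a, b) *+ n = (a *+ n, b *+ n).
Proof. by elim: n => // n IHn; rewrite !mulrS IHn. Qed.

Lemma Zmod_mulrn n (t : 'I_n.+1) : inZp 1 *+ t = t.
Proof. by rewrite Zp_mulrn; apply: val_inj; rewrite /= modnMml mul1n modn_small. Qed.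

Lemma mulrn_exp_totient (A : finZmodType) q e (g : A) :
  coprime q #|A| -> (0 < q)%N -> g *+ (q ^ (totient #|A| * e)) = g.
Proof.
move=> co q_gt0; set Q := (q ^ _)%N.
have Q_gt0 : (0 < Q)%N by rewrite expn_gt0 q_gt0.
have /dvdnP[x xE] : (#|A| %| Q - 1)%N.
  by rewrite -eqn_mod_dvd // /Q expnM -modnXm Euler_exp_totient // modnXm exp1n.
by rewrite -(subnK Q_gt0) xE mulrnDr mulnC mulrnA finZmod_mulrn_card mul0rn add0r.
Qed.

Theorem corollary4p1 (p nu k m : nat) (F : finFieldType) (A : finZmodType)
    (p_prime : prime p) (nu_gt0 : (0 < nu)%N) (cardF : #|F| = (p ^ nu)%N)
    (cardA : #|A| = m) (p_ndiv_m : ~~ (p %| m)%N) :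
  [/\ avg_hull_dim F (A * Zmod (p ^ k))%type < (m * p ^ k)%:R / 3%:R,
      avg_hull_dim F A = (m%:R - #|self_paired A (p ^ nu)|%:R) / 4%:R
    & avg_hull_dim F A <= (m%:R - 1) / 4%:R].
Proof.
have q_gt0 : (0 < #|F|)%N by rewrite ltnW // card_finNzRing_gt1.
have co : coprime #|F| #|A| by rewrite cardF cardA coprimeXl // prime_coprime.
have m_gt0 : (0 < #|A|)%N by apply/card_gt0P; exists 0.
(* By Euler the totient gives q^D = 1 modulo |A|; the factor [k.+1] makes p^k divide q^D and keeps D
   positive when k = 0. *)
pose D := (totient #|A| * k.+1)%N.
have D_gt0 : (0 < D)%N by rewrite muln_gt0 totient_gt0 m_gt0.
have mulQ (g : A) : g *+ (#|F| ^ D) = g by apply: mulrn_exp_totient.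
have part2 : avg_hull_dim F A = (m%:R - #|self_paired A (p ^ nu)|%:R) / 4%:R.
  rewrite (@avg_hull_dim_semisimple p nu 0 D F A 0) //.
  - rewrite -cardA -(sum_starT_moved p_prime cardF D_gt0 mulQ) -cardF.
    by rewrite natrD addrK.
  - by move=> g; exists 0%N; rewrite mulQ addr0.
  - rewrite mul1n; apply: eq_card => g; apply/esym/imsetP.
    by exists g; rewrite ?mulQ.
split=> //; last first.
  rewrite part2 ler_pM2r ?invr_gt0 ?ltr0n // lerD2l lerN2 ler1n.
  apply/card_gt0P; exists 0; rewrite inE; apply/cyclotomicP.
  by exists 0%N; rewrite oppr0.
have N_gt0 : (0 < p ^ k)%N by rewrite expn_gt0 prime_gt0.
have cardZ : #|Zmod (p ^ k)| = (p ^ k)%N by rewrite card_ord prednK.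
have mulN (t : Zmod (p ^ k)) : t *+ p ^ k = 0.
  by have := finZmod_mulrn_card t; rewrite cardZ.
have mulQt (t : Zmod (p ^ k)) : t *+ (#|F| ^ D) = 0.
  have /dvdnP[x ->] : (p ^ k %| #|F| ^ D)%N.
    rewrite cardF -expnM dvdn_exp2l // /D mulnA.
    apply: leq_trans (leqnSn k) _; rewrite -[leqLHS]mul1n leq_pmul2r //.
    by rewrite muln_gt0 nu_gt0 totient_gt0 m_gt0.
  by rewrite mulnC mulrnA mulN mul0rn.
have mulQG (g : A * Zmod (p ^ k)) : g *+ (#|F| ^ D) = (g.1, 0).
  by case: g => a t; rewrite pair_mulrn mulQ mulQt.
have cardG : #|{: A * Zmod (p ^ k)}| = (m * p ^ k)%N by rewrite card_prod cardZ cardA.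
rewrite -cardG; apply: (@avg_hull_dim_lt p nu k D F _ (0, inZp 1)) => //.
- by move=> g; rewrite !mulQG.
- by rewrite pair_mulrn mul0rn mulN.
- move=> [a t]; exists t; rewrite mulQG pair_mulrn mul0rn Zmod_mulrn.
  by congr (_, _); rewrite /= ?addr0 ?add0r.
rewrite cardG mulnC -cardA -(card_imset [in A] (f := fun a => (a, 0 : Zmod (p ^ k)))).
  congr (_ * _)%N; apply: eq_card => g; apply/imsetP/imsetP => [[a _ ->]|[h _ ->]].
    by exists (a, 0); rewrite ?mulQG.
  by exists h.1; rewrite ?mulQG.
by move=> a b [].
Qed.
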